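(* Let $n,m\ge 2$. Then A wins the gp achievement game on $K_n\,\square\,K_m$ if and only if both $n$ and $m$ are odd.
   Context: A general position set of a graph $G$ is a set $S\subseteq V(G)$ such that no three vertices of $S$ lie on a common shortest path of $G$. The gp achievement game on a graph: players A and B alternately select vertices, A first; a selection is legal if the vertex has not been selected before and the set of all vertices selected so far (including it) is a general position set. The game ends when no legal move exists, and the player who selected the last vertex wins; ''a player wins the game'' means that player has a winning strategy. The Cartesian product $G\,\square\,H$ has vertex set $V(G)\times V(H)$, with $(g_1,h_1)$ adjacent to $(g_2,h_2)$ iff either $g_1g_2\in E(G)$ and $h_1=h_2$, or $g_1=g_2$ and $h_1h_2\in E(H)$. $K_n$ is the complete graph on $n$ vertices. *)

(* Defs.v *)
From mathcomp Require Import all_boot.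
Set Implicit Arguments.
Unset Strict Implicit.
Unset Printing Implicit Defensive.

Record sgraph := SGraph {
  vertex :> finType;
  adj : rel vertex;
  adj_sym : symmetric adj;
  adj_irr : irreflexive adj }.

Definition complete_adj (n : nat) : rel 'I_n := [rel x y | x != y].

Lemma complete_adj_sym n : symmetric (@complete_adj n).
Proof. by move=> x y; rewrite /complete_adj /= eq_sym. Qed.

Lemma complete_adj_irr n : irreflexive (@complete_adj n).
Proof. by move=> x; rewrite /complete_adj /= eqxx. Qed.

Definition complete_graph (n : nat) : sgraph :=
  SGraph (@complete_adj_sym n) (@complete_adj_irr n).

Definition cart_adj (G H : sgraph) : rel (G * H)%type :=
  [rel x y | (adj x.1 y.1 && (x.2 == y.2)) || ((x.1 == y.1) && adj x.2 y.2)].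

Lemma cart_adj_sym G H : symmetric (@cart_adj G H).
Proof.
move=> x y; rewrite /cart_adj /= (adj_sym x.1) (adj_sym x.2).
by rewrite (eq_sym x.1) (eq_sym x.2).
Qed.

Lemma cart_adj_irr G H : irreflexive (@cart_adj G H).
Proof. by move=> x; rewrite /cart_adj /= !adj_irr andbF. Qed.

Definition cart_prod (G H : sgraph) : sgraph :=
  SGraph (@cart_adj_sym G H) (@cart_adj_irr G H).

(* The path has vertex sequence x :: p, hence length size p; minimality over
   walks is the same as minimality over paths. *)
Definition shortest_path (G : sgraph) (x : G) (p : seq G) : Prop :=
  path (@adj G) x p /\
  forall q : seq G,
    path (@adj G) x q -> last x q = last x p -> size p <= size q.

Definition general_position (G : sgraph) (S : {set G}) : Prop :=
  forall u v w : G,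
    u \in S -> v \in S -> w \in S -> u != v -> u != w -> v != w ->
    ~ exists (x : G) (p : seq G),
        [/\ shortest_path x p, u \in x :: p, v \in x :: p & w \in x :: p].

(* A position of the game is the history h of the vertices selected so far, in
   chronological order. *)
Definition legal_move (G : sgraph) (h : seq G) (v : G) : Prop :=
  v \notin h /\ general_position [set x in rcons h v].

Definition game_over (G : sgraph) (h : seq G) : Prop :=
  forall v : G, ~ legal_move h v.

Inductive player := PlayerA | PlayerB.

Definition to_move (T : Type) (h : seq T) : player :=
  if odd (size h) then PlayerB else PlayerA.

Definition last_player (T : Type) (h : seq T) : option player :=
  if size h is k.+1 then Some (if odd k then PlayerB else PlayerA) else None.

(* A strategy maps each history to the vertex to be selected next; its values
   at histories where the other player moves are irrelevant. *)
Definition strategy (G : sgraph) := seq G -> G.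

Inductive consistent_play (G : sgraph) (P : player) (s : strategy G) :
    seq G -> Prop :=
| ConsistentNil : consistent_play P s [::]
| ConsistentRcons (h : seq G) (v : G) :
    consistent_play P s h -> legal_move h v -> (to_move h = P -> v = s h) ->
    consistent_play P s (rcons h v).

(* The first conjunct prevents a strategy from winning vacuously by proposing
   illegal moves. *)
Definition winning_strategy (G : sgraph) (P : player) (s : strategy G) : Prop :=
  forall h : seq G, consistent_play P s h ->
    (to_move h = P -> ~ game_over h -> legal_move h (s h)) /\
    (game_over h -> last_player h = Some P).

Definition wins (G : sgraph) (P : player) : Prop :=
  exists s : strategy G, winning_strategy P s.

(* Main.v *)
Require Import Defs.
From mathcomp Require Import all_boot.
Set Implicit Arguments.
Unset Strict Implicit.
Unset Printing Implicit Defensive.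

(** Distances in K_n □ K_m are at most 2, so a set of cells of the n x m grid is
    in general position iff no cell of it shares its row with a second cell and
    its column with a third one; viewing cells as edges of K_{n,m}, iff it is a
    star forest.  Call a position balanced if the numbers of empty rows and of
    empty columns are both even.  Every legal move from a balanced position can
    be answered by a legal move to a balanced one: a move that occupies a new row
    and a new column is answered by another such move, and a move that extends a
    star along a line is answered by extending the same star along that line.
    Hence whoever first leaves a balanced position to the opponent moves last.
    If n and m are odd, A's first move does so.  Otherwise B's first move does
    (or the empty board is balanced already): when exactly one of n, m is even,
    B answers A's first move on the line that makes it balanced. *)

(** * Star forests and balanced sets of cells *)

Section StarForest.
Variables I J : finType.
Implicit Types (S : {set I * J}) (u v w : I * J).

(** The forbidden triple is a path of three edges of [K_{n,m}] with middle edge [v]; a bipartite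
    graph has no triangle, so without such paths its components are stars. *)
Definition star_forest S : bool :=
  [forall u in S, forall v in S, forall w in S,
     (u.1 == v.1) ==> (v.2 == w.2) ==> (u == v) || (v == w)].

Lemma star_forestP S :
  reflect (forall u v w, u \in S -> v \in S -> w \in S ->
             u.1 = v.1 -> v.2 = w.2 -> u = v \/ v = w) (star_forest S).
Proof.
apply: (iffP forall_inP) => [H u v w uS vS wS e1 e2 | H u uS].
  have /forall_inP/(_ v vS)/forall_inP/(_ w wS) := H u uS.
  by rewrite e1 e2 !eqxx /= => /orP[]/eqP; [left | right].
apply/forall_inP => v vS; apply/forall_inP => w wS.
apply/implyP => /eqP e1; apply/implyP => /eqP e2.
by have [->|->] := H u v w uS vS wS e1 e2; rewrite eqxx ?orbT.
Qed.

(** Equal parity of occupied lines and all lines means evenly many empty ones, without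
    subtraction. *)
Definition balanced S : bool :=
  (odd #|fst @: S| == odd #|I|) && (odd #|snd @: S| == odd #|J|).

Lemma exists_notin_odd (T : finType) (A : {set T}) :
  odd #|A| != odd #|T| -> exists x, x \notin A.
Proof.
move=> H; have /existsP[x xA] : [exists x, x \notin A]; last by exists x.
apply: contraR H => /existsPn H.
suff -> : A = setT by rewrite cardsT.
by apply/setP => x; rewrite inE; apply/negPn/H.
Qed.

Lemma star_forest_new_edge S i j :
  star_forest S -> i \notin fst @: S -> j \notin snd @: S ->
  star_forest ((i, j) |: S).
Proof.
move=> /star_forestP sfS niS njS; apply/star_forestP.
have Ni z : z.1 = i -> z \notin S.
  by move=> zi; apply: contra niS => zS; rewrite -zi imset_f.
have Nj z : z.2 = j -> z \notin S.
  by move=> zj; apply: contra njS => zS; rewrite -zj imset_f.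
move=> u v w /setU1P[-> | uS] /setU1P[-> | vS] /setU1P[-> | wS] //=; auto.
- by move=> /esym/Ni/negP[].
- by move=> /esym/Ni/negP[].
- by move=> /Ni/negP[].
- by move=> _ /Nj/negP[].
Qed.

(** Alone in its row, the new cell can only be the end [w] of a forbidden triple; the hypothesis on
    column [j] excludes that. *)
Lemma star_forest_col S i j :
  star_forest S -> i \notin fst @: S ->
  (forall u v, u \in S -> v \in S -> v.2 = j -> u.1 = v.1 -> u = v) ->
  star_forest ((i, j) |: S).
Proof.
move=> /star_forestP sfS niS jC; apply/star_forestP.
have Ni z : z.1 = i -> z \notin S.
  by move=> zi; apply: contra niS => zS; rewrite -zi imset_f.
move=> u v w /setU1P[-> | uS] /setU1P[-> | vS] /setU1P[-> | wS] //=; auto.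
- by move=> /esym/Ni/negP[].
- by move=> /esym/Ni/negP[].
- by move=> /Ni/negP[].
Qed.

Lemma star_forest_row S i j :
  star_forest S -> j \notin snd @: S ->
  (forall v w, v \in S -> w \in S -> v.1 = i -> v.2 = w.2 -> v = w) ->
  star_forest ((i, j) |: S).
Proof.
move=> /star_forestP sfS njS iC; apply/star_forestP.
have Nj z : z.2 = j -> z \notin S.
  by move=> zj; apply: contra njS => zS; rewrite -zj imset_f.
move=> u v w /setU1P[-> | uS] /setU1P[-> | vS] /setU1P[-> | wS] //=; auto.
- by move=> _ /Nj/negP[].
- by move=> _ /esym/Nj/negP[].
- by move=> _ /Nj/negP[].
Qed.

Lemma balanced_reply S v :
  balanced S -> v \notin S -> star_forest (v |: S) ->
  exists v', [/\ v' \notin v |: S, star_forest (v' |: (v |: S)) &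
                 balanced (v' |: (v |: S))].
Proof.
case: v => i j /andP[/eqP bI /eqP bJ] nvS sfS.
have notin1 (A : {set I * J}) (z : I * J) : z.1 \notin fst @: A -> z \notin A.
  by apply: contraNN => zA; rewrite imset_f.
have notin2 (A : {set I * J}) (z : I * J) : z.2 \notin snd @: A -> z \notin A.
  by apply: contraNN => zA; rewrite imset_f.
have sf := elimT (star_forestP _) sfS.
have vU : (i, j) \in (i, j) |: S by rewrite setU11.
have SU z : z \in S -> z \in (i, j) |: S by move=> zS; rewrite setU1r.
have [/imsetP[x xS /= ix]|ni] := boolP (i \in fst @: S);
  have [/imsetP[y yS /= jy]|nj] := boolP (j \in snd @: S).
- have [xv | vy] := sf x (i, j) y (SU x xS) vU (SU y yS) (esym ix) jy.
    by rewrite -xv xS in nvS.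
  by rewrite vy yS in nvS.
- have iS : i \in fst @: S by rewrite ix imset_f.
  have [|j' nj'] := @exists_notin_odd _ (snd @: ((i, j) |: S)).
    by rewrite imsetU1 cardsU1 nj oddD bJ /=; case: odd.
  exists (i, j'); split; first exact: notin2.
    apply: star_forest_row => // v w vS wS vi vw.
    (* Row [i] contains both [x] and [(i, j)], so each of its cells has a neighbour in the row and
       must be alone in its column. *)
    have [vE|nv] := eqVneq v (i, j).
      have [| xv | //] := sf x v w (SU x xS) vS wS _ vw; first by rewrite vi.
      by rewrite -vE -xv xS in nvS.
    have [vE | //] := sf (i, j) v w vU vS wS (esym vi) vw.
    by rewrite -vE eqxx in nv.
  move: nj'; rewrite /balanced !imsetU1 /= => nj'.
  rewrite !cardsU1 nj' nj !inE iS eqxx /= !oddD bI bJ !eqxx /=.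
  by case: (odd #|J|).
- have jS : j \in snd @: S by rewrite jy imset_f.
  have [|i' ni'] := @exists_notin_odd _ (fst @: ((i, j) |: S)).
    by rewrite imsetU1 cardsU1 ni oddD bI /=; case: odd.
  exists (i', j); split; first exact: notin1.
    apply: star_forest_col => // u v uS vS vj uv.
    have [vE|nv] := eqVneq v (i, j).
      have [| // | vy] := sf u v y uS vS (SU y yS) uv; first by rewrite vj.
      by rewrite -vE vy yS in nvS.
    have [// | vE] := sf u v (i, j) uS vS vU uv vj.
    by rewrite vE eqxx in nv.
  move: ni'; rewrite /balanced !imsetU1 /= => ni'.
  rewrite !cardsU1 ni' ni !inE jS eqxx /= !oddD bI bJ !eqxx /=.
  by case: (odd #|I|).
have [|i' ni'] := @exists_notin_odd _ (fst @: ((i, j) |: S)).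
  by rewrite imsetU1 cardsU1 ni oddD bI /=; case: odd.
have [|j' nj'] := @exists_notin_odd _ (snd @: ((i, j) |: S)).
  by rewrite imsetU1 cardsU1 nj oddD bJ /=; case: odd.
exists (i', j'); split; [exact: notin1 | exact: star_forest_new_edge |].
move: ni' nj'; rewrite /balanced !imsetU1 /= => ni' nj'.
rewrite !cardsU1 ni' nj' ni nj /= !oddD bI bJ.
by case: (odd #|I|); case: (odd #|J|).
Qed.

Lemma star_forest1 v : star_forest [set v].
Proof. by apply/star_forestP => u x w /set1P-> /set1P->; left. Qed.

Lemma balanced1 v : odd #|I| -> odd #|J| -> balanced [set v].
Proof. by rewrite /balanced !imset_set1 !cards1 => -> ->. Qed.

Lemma balanced0 : ~~ odd #|I| -> ~~ odd #|J| -> balanced set0.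
Proof. by rewrite /balanced !imset0 !cards0 => /negbTE-> /negbTE->. Qed.

Lemma opening_reply v :
  ~~ (odd #|I| && odd #|J|) ->
  exists v', [/\ v' \notin [set v], star_forest (v' |: [set v]) &
                 balanced (v' |: [set v])].
Proof.
case: v => i j; case oI: (odd #|I|); case oJ: (odd #|J|) => // _.
(* One occupied row already has the parity of [#|I|]; only a second column is missing, so the reply
   stays in row [i]. *)
- have [|j' nj'] := @exists_notin_odd _ [set j]; first by rewrite cards1 oJ.
  have nij : (i, j') \notin [set (i, j)].
    by move: nj'; rewrite !inE xpair_eqE eqxx.
  exists (i, j'); split=> //.
    apply: star_forest_row; rewrite ?star_forest1 ?imset_set1 //.
    by move=> v w /set1P-> /set1P->.
  rewrite /balanced !imsetU1 !imset_set1 /= setUid !cardsU1 nj' !cards1.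
  by rewrite oI oJ.
- have [|i' ni'] := @exists_notin_odd _ [set i]; first by rewrite cards1 oI.
  have nij : (i', j) \notin [set (i, j)].
    by move: ni'; rewrite !inE xpair_eqE eqxx andbT.
  exists (i', j); split=> //.
    apply: star_forest_col; rewrite ?star_forest1 ?imset_set1 //.
    by move=> u v /set1P-> /set1P->.
  rewrite /balanced !imsetU1 !imset_set1 /= setUid !cardsU1 ni' !cards1.
  by rewrite oI oJ.
have := @balanced_reply set0 (i, j).
rewrite setU0 inE; apply=> //; last exact: star_forest1.
by apply: balanced0; rewrite ?oI ?oJ.
Qed.

End StarForest.

(** * General position in the product of two complete graphs *)

Section RookGraph.
Variables n m : nat.
Let G := cart_prod (complete_graph n) (complete_graph m).
Local Arguments adj : simpl never.

Lemma rook_adjE (x y : G) :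
  adj x y = ((x.1 != y.1) && (x.2 == y.2)) || ((x.1 == y.1) && (x.2 != y.2)).
Proof. by []. Qed.

Lemma rook_short_path (x y : G) :
  exists2 q, path (@adj G) x q & last x q = y /\ size q <= 2.
Proof.
have [e1|n1] := eqVneq x.1 y.1; have [e2|n2] := eqVneq x.2 y.2.
- by exists [::] => //; split=> //; case: x y e1 e2 => ? ? [? ?] /= -> ->.
- by exists [:: y] => //=; rewrite rook_adjE e1 n2 eqxx.
- by exists [:: y] => //=; rewrite rook_adjE e2 n1 eqxx.
exists [:: ((x.1, y.2) : G); y] => //=.
by rewrite !rook_adjE /= !eqxx n1 n2 orbT.
Qed.

Lemma general_position_star_forest (S : {set G}) :
  general_position S <-> @star_forest 'I_n 'I_m S.
Proof.
split=> [gpS | /star_forestP sfS u v w uS vS wS uv uw vw].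
  apply/star_forestP => u v w uS vS wS e1 e2.
  have [-> | nuv] := eqVneq u v; first by left.
  have [-> | nvw] := eqVneq v w; first by right.
  have n2 : u.2 != v.2.
    by move: nuv; rewrite -!pair_eqE /pair_eq /= e1 eqxx.
  have n1 : v.1 != w.1.
    by move: nvw; rewrite -!pair_eqE /pair_eq /= e2 eqxx andbT.
  (* [u] and [w] differ in both coordinates, hence are at distance 2, and the path turning at [v] is
     shortest. *)
  have nuw : u != w by apply: contraNneq n1 => <-; rewrite e1.
  case: (gpS u v w uS vS wS nuv nuw nvw).
  exists u, [:: v; w]; split; rewrite ?inE ?eqxx ?orbT //; split.
    by rewrite /= !rook_adjE e1 e2 !eqxx n1 -e2 n2.
  case=> [|a [|b q]] //=; first by move=> _ /eqP; rewrite (negbTE nuw).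
  move=> + aw; rewrite {}aw rook_adjE e1 -e2.
  by rewrite (negbTE n1) (negbTE n2).
case=> x [p [[xp minp] ux vx wx]].
have [q xq [lq sq]] := rook_short_path x (last x p).
have sp : size p <= 2 := leq_trans (minp q xq lq) sq.
have uniq3 : uniq [:: u; v; w] by rewrite /= !inE negb_or uv uw vw.
have sub3 : {subset [:: u; v; w] <= x :: p}.
  by move=> z; rewrite !inE => /or3P[]/eqP->.
(* A shortest path has at most three vertices, so it consists of [u], [v], [w] in some order. *)
have [sz eq3] := uniq_min_size uniq3 sub3 sp.
have inS z : z \in x :: p -> z \in S.
  by rewrite -eq3 !inE => /or3P[]/eqP->.
case: p xp minp inS sz {ux vx wx lq sp sub3 eq3} => [|b [|c []]] //=.
rewrite andbT => /andP[xb bc] minp inS _.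
have nxc : ~~ adj x c.
  by apply/negP => xc; have := minp [:: c]; rewrite /= xc => /(_ isT erefl).
have nxeqc : x != c by apply/eqP => xc; have := minp [::] isT xc.
have [xS bS cS] : [/\ x \in S, b \in S & c \in S].
  by split; apply: inS; rewrite !inE eqxx ?orbT.
(* Two steps along one line would make [x] and [c] equal or adjacent; a turn at [b] is a forbidden
   triple. *)
move: nxc xb bc; rewrite !rook_adjE => nxc.
case/orP=> /andP[] => [nxb /eqP exb|/eqP exb nxb];
  case/orP=> /andP[] => [nbc /eqP ebc|/eqP ebc nbc].
- move: nxc nxeqc; rewrite -pair_eqE /pair_eq /= exb ebc eqxx andbT => /norP[].
  by rewrite andbT => /negPn->.
- have [cb | bx] := sfS c b x cS bS xS (esym ebc) (esym exb).
    by rewrite cb eqxx in nbc.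
  by rewrite bx eqxx in nxb.
- have [xb | bc] := sfS x b c xS bS cS exb ebc.
    by rewrite xb eqxx in nxb.
  by rewrite bc eqxx in nbc.
- move: nxc nxeqc; rewrite -pair_eqE /pair_eq /= exb ebc eqxx => /norP[_].
  by rewrite /= => /negPn->.
Qed.

(** * The game and its strategies *)

Definition occupied (h : seq G) : {set 'I_n * 'I_m} := [set x in h].

Lemma occupied_rcons h v : occupied (rcons h v) = v |: occupied h.
Proof. by apply/setP => x; rewrite !inE mem_rcons inE. Qed.

Lemma occupied_nil : occupied [::] = set0.
Proof. by apply/setP => x; rewrite !inE. Qed.

Definition legalb (h : seq G) (v : G) : bool :=
  (v \notin occupied h) && star_forest (v |: occupied h).

Lemma legalP (h : seq G) (v : G) : reflect (legal_move h v) (legalb h v).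
Proof.
apply: (iffP andP); rewrite /legal_move -occupied_rcons inE.
  by case=> vh /general_position_star_forest.
by case=> vh /general_position_star_forest.
Qed.

Lemma legal_nil (v : G) : legal_move [::] v.
Proof. by apply/legalP; rewrite /legalb occupied_nil inE setU0 star_forest1. Qed.

Lemma legal_reply (h : seq G) (v : G) :
  balanced (occupied h) \/ h = [::] /\ ~~ (odd n && odd m) -> legal_move h v ->
  exists2 v', legal_move (rcons h v) v' &
              balanced (occupied (rcons (rcons h v) v')).
Proof.
move=> H /legalP/andP[vh sfv].
suff [v' [v'h sfv' bv']] : exists v',
    [/\ v' \notin v |: occupied h, star_forest (v' |: (v |: occupied h))
      & balanced (v' |: (v |: occupied h))].
  exists v'; last by rewrite !occupied_rcons.
  by apply/legalP; rewrite /legalb occupied_rcons v'h.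
case: H => [bh | [-> nodd]]; first exact: balanced_reply.
by rewrite occupied_nil setU0; apply: opening_reply; rewrite !card_ord.
Qed.

Lemma consistent_uniq P (s : strategy G) h : consistent_play P s h -> uniq h.
Proof. by elim=> // {}h v _ uh [vh _] _; rewrite rcons_uniq vh. Qed.

(** Playing balancing replies against [s] leads from one such position, with A to move, to a longer
    one; the finite board forbids this, by induction on the number of free vertices. *)
Lemma not_winning_A (s : strategy G) h :
  winning_strategy PlayerA s -> consistent_play PlayerA s h ->
  ~~ odd (size h) ->
  ~ (balanced (occupied h) \/ h = [::] /\ ~~ (odd n && odd m)).
Proof.
move=> win; have [k] := ubnP (#|G| - size h).
elim: k h => // k IHk h ltk ch evh bh.
have [wmove wover] := win h ch.
have mvA : to_move h = PlayerA by rewrite /to_move (negbTE evh).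
(* After an even number of moves the last player is B, or nobody, so a winning [s] cannot have
   stopped here. *)
have nover : ~ game_over h.
  move/wover; rewrite /last_player; case: (size h) evh => //= l.
  by rewrite negbK => ->.
have lm := wmove mvA nover.
have [v' lv' bv'] := legal_reply bh lm.
have c1 : consistent_play PlayerA s (rcons h (s h)) by apply: ConsistentRcons.
have c2 : consistent_play PlayerA s (rcons (rcons h (s h)) v').
  by apply: ConsistentRcons => //; rewrite /to_move size_rcons /= evh.
apply: (IHk _ _ c2); rewrite ?size_rcons /= ?negbK //; last by left.
have := consistent_uniq c2 => /card_uniqP.
have := max_card (mem (rcons (rcons h (s h)) v')) => /[swap] ->.
rewrite !size_rcons => szle; rewrite -ltnS; apply: leq_trans ltk.
by rewrite ltnS; apply: ltn_sub2l => //; apply: ltn_trans szle.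
Qed.

(** The default [x0] is returned where no balancing move exists; it need not be legal. *)
Definition balancing_strategy (x0 : G) : strategy G := fun h =>
  odflt x0 [pick v : G | legalb h v && balanced (occupied (rcons h v))].

Lemma balancing_strategyP (x0 : G) (h : seq G) (v : G) :
  legal_move h v -> balanced (occupied (rcons h v)) ->
  legal_move h (balancing_strategy x0 h) /\
  balanced (occupied (rcons h (balancing_strategy x0 h))).
Proof.
move=> /legalP lv bv; rewrite /balancing_strategy.
case: pickP => [w /andP[/legalP lw bw] // | /(_ v)].
by rewrite lv bv.
Qed.

Lemma balancing_strategy_wins x0 :
  odd n -> odd m -> winning_strategy PlayerA (balancing_strategy x0).
Proof.
move=> on om.
set s := balancing_strategy x0.
(* The even case provides a legal move whenever A is to move, so the game can end only after a move
   of A. *)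
have inv h : consistent_play PlayerA s h ->
    if odd (size h) then is_true (balanced (occupied h)) else
    legal_move h (s h) /\ balanced (occupied (rcons h (s h))).
  elim=> [|{}h v ch IH lv vs] /=.
    apply: (@balancing_strategyP _ _ x0); first exact: legal_nil.
    by rewrite occupied_rcons occupied_nil setU0 balanced1 ?card_ord.
  rewrite size_rcons /=; case: ifP IH vs; rewrite /to_move => -> /=.
    move=> bh _; have [v' lv' bv'] := legal_reply (or_introl bh) lv.
    exact: balancing_strategyP lv' bv'.
  by move=> [_ bh] ->.
move=> h ch; have := inv h ch; rewrite /to_move /last_player.
case: (size h) => [|k] /=; first by case=> lh _; split=> // /(_ (s h)).
case: (odd k) => /=; last by split.
by case=> lh _; split=> // /(_ (s h)).
Qed.

End RookGraph.

Theorem theorem3p6 (n m : nat) (hn : 2 <= n) (hm : 2 <= m) :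
  wins (cart_prod (complete_graph n) (complete_graph m)) PlayerA <->
  odd n /\ odd m.
Proof.
split=> [[s win] | [on om]].
  apply/andP/negPn/negP => nodd.
  by apply: (not_winning_A win (ConsistentNil _ _)) => //; right.
exists (@balancing_strategy n m (Ordinal (ltnW hn), Ordinal (ltnW hm))).
exact: balancing_strategy_wins.
Qed.
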